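(* Let $\vdash$ be a protoalgebraic deductive system with an inconsistency lemma. Then the following conditions are equivalent. (i) $\vdash$ has a weak excluded middle law (WEML). (ii) Whenever $F$ is a meet-irreducible $\vdash$-filter of an algebra $\boldsymbol{A}$, with $F\neq A$, then the interval $[F,A)$ in the $\vdash$-filter lattice of $\boldsymbol{A}$ has a greatest element. (iii) For each $\vdash$-subdirectly irreducible reduced matrix model $\langle\boldsymbol{A},F\rangle$ of $\vdash$, the interval $[F,A)$ of the $\vdash$-filter lattice of $\boldsymbol{A}$ has a greatest element.
   Context: Deductive systems. Fix an algebraic signature and an infinite set of variables; $\mathit{Fm}$ is the set of formulas (terms) and $\boldsymbol{Fm}$ the absolutely free algebra of formulas. Substitutions are endomorphisms of $\boldsymbol{Fm}$. A deductive system $\vdash$ is a relation from sets of formulas to formulas that is reflexive ($\Gamma\vdash\alpha$ if $\alpha\in\Gamma$), transitive (if $\Gamma\vdash\alpha$ for all $\alpha\in\Pi$ and $\Pi\vdash\beta$, then $\Gamma\vdash\beta$), finitary (if $\Gamma\vdash\alpha$ then $\Gamma'\vdash\alpha$ for some finite $\Gamma'\subseteq\Gamma$) and substitution-invariant (if $\Gamma\vdash\alpha$ then $s[\Gamma]\vdash s(\alpha)$ for every substitution $s$). $\Gamma\vdash\Pi$ means $\Gamma\vdash\alpha$ for all $\alpha\in\Pi$. Let $v_1,v_2,\dots$ be a fixed sequence of distinct variables, $\mathbb{N}^+=\{1,2,\dots\}$, and let $\mathit{Fm}(n)$ be the set of formulas whose variables are among $v_1,\dots,v_n$. For $\Psi\subseteq\mathit{Fm}(n)$,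 $\Psi(\alpha_1,\dots,\alpha_n)$ denotes the result of substituting $\alpha_i$ for $v_i$ in all members of $\Psi$. $\vdash$ is protoalgebraic if there is a set $\Lambda\subseteq\mathit{Fm}(2)$ such that $\emptyset\vdash\Lambda(v_1,v_1)$ and $\{v_1\}\cup\Lambda(v_1,v_2)\vdash v_2$. Inconsistency lemma and WEML. A set $\Xi$ of formulas is inconsistent in $\vdash$ if $\Xi\vdash\alpha$ for all $\alpha\in\mathit{Fm}$. An elementary IL-sequence for $\vdash$ is a family $\{\Psi_n:n\in\mathbb{N}^+\}$ of finite sets $\Psi_n\subseteq\mathit{Fm}(n)$ such that for all $n\in\mathbb{N}^+$ and all $\Gamma\cup\{\alpha_1,\dots,\alpha_n\}\subseteq\mathit{Fm}$: $\Gamma\cup\{\alpha_1,\dots,\alpha_n\}$ is inconsistent in $\vdash$ iff $\Gamma\vdash\Psi_n(\alpha_1,\dots,\alpha_n)$. $\vdash$ has an inconsistency lemma (IL) if it has an elementary IL-sequence. Given such a sequence, let $\#n=|\Psi_n|$, $\Psi_n=\{\psi_n^1,\dots,\psi_n^{\#n}\}$ and $\Psi_{\#n}\Psi_n=\Psi_{\#n}(\psi_n^1,\dots,\psi_n^{\#n})\subseteq\mathit{Fm}(n)$ (the order of enumeration is immaterial up to interderivability). $\vdash$ has a WEML if it has an elementary IL-sequence $\{\Psi_n\}$ such that for all $n\in\mathbb{N}^+$ and all $\Gamma\cup\{\alpha_1,\dots,\alpha_n,\varphi\}\subseteq\mathit{Fm}$: if $\Gamma\cup\Psi_n(\alpha_1,\dots,\alpha_n)\vdash\varphi$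 and $\Gamma\cup\Psi_{\#n}\Psi_n(\alpha_1,\dots,\alpha_n)\vdash\varphi$, then $\Gamma\vdash\varphi$. (If $\Psi_n=\emptyset$, this condition for $n$ is trivially true.) Filters and matrices. Algebras are non-empty and have the signature of $\vdash$. A $\vdash$-filter of an algebra $\boldsymbol{A}$ is a set $F\subseteq A$ such that whenever $\Gamma\vdash\alpha$ and $h\colon\boldsymbol{Fm}\to\boldsymbol{A}$ is a homomorphism with $h[\Gamma]\subseteq F$, then $h(\alpha)\in F$; in this case $\langle\boldsymbol{A},F\rangle$ is called a matrix model of $\vdash$. The $\vdash$-filters of $\boldsymbol{A}$ form an algebraic lattice under inclusion. In it, $[F,A)$ denotes the set of $\vdash$-filters $G$ with $F\subseteq G\subsetneq A$. ''$F$ is meet-irreducible'' means it is meet-irreducible in the $\vdash$-filter lattice of $\boldsymbol{A}$. A matrix model $\langle\boldsymbol{A},F\rangle$ is reduced if every congruence of $\boldsymbol{A}$ that identifies two distinct elements of $A$ also identifies an element of $F$ with a non-element of $F$. A reduced matrix model $\langle\boldsymbol{A},F\rangle$ is $\vdash$-subdirectly irreducible if $F$ is completely meet-irreducible in the $\vdash$-filter lattice of $\boldsymbol{A}$ (the top of a complete lattice is not completely meet-irreducible, being the meet of $\emptyset$). *)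

(* Defs.v *)
From mathcomp Require Import all_boot.
From mathcomp Require Import boolp classical_sets functions cardinality.

Set Implicit Arguments.
Unset Strict Implicit.
Unset Printing Implicit Defensive.

Local Open Scope classical_set_scope.

Record signature := Signature {
  op :> Type;
  arity : op -> nat
}.

(* An infinite set of variables together with the fixed sequence of distinct
   variables; it is indexed from 0, so that [vseq V i] is v_(i+1). *)
Record variables := Variables {
  var :> Type;
  vseq : nat -> var;
  vseq_inj : injective vseq
}.

Record algebra (S : signature) := Algebra {
  carrier :> Type;
  opA : forall o : S, ('I_(arity o) -> carrier) -> carrier;
  algebra_nonempty : inhabited carrier
}.
Arguments opA {S a} o _.

Definition hom (S : signature) (A B : algebra S) (h : A -> B) : Prop :=
  forall (o : S) (a : 'I_(arity o) -> A), h (opA o a) = opA o (h \o a).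

Inductive formula (S : signature) (V : variables) : Type :=
| Var of V
| App (o : S) of 'I_(arity o) -> formula S V.
Arguments Var {S V} _.
Arguments App {S V} o _.

Definition Fm (S : signature) (V : variables) : algebra S :=
  @Algebra S (formula S V) (@App S V) (inhabits (Var (vseq V 0))).

Section Formulas.
Variables (S : signature) (V : variables).
Local Notation Fm := (Fm S V).

Fixpoint vars (phi : formula S V) : set V :=
  match phi with
  | Var x => [set x]
  | App o a => \bigcup_i vars (a i)
  end.

(* Fm(n) *)
Definition Fm_below (n : nat) : set Fm :=
  [set phi | vars phi `<=` [set vseq V i | i in `I_n]].

(* The homomorphic extension of an assignment of the variables. *)
Fixpoint eval (A : algebra S) (e : V -> A) (phi : formula S V) : A :=
  match phi with
  | Var x => e x
  | App o a => opA o (fun i => eval e (a i))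
  end.

(* v_1, ..., v_n go to alpha_1, ..., alpha_n; other variables are fixed. *)
Definition assign (n : nat) (alpha : 'I_n -> Fm) : V -> Fm :=
  fun x => if [pick i : 'I_n | `[< x = vseq V i >]] is Some i
           then alpha i else Var x.

(* Psi(alpha_1, ..., alpha_n) *)
Definition inst (n : nat) (Psi : set Fm) (alpha : 'I_n -> Fm) : set Fm :=
  eval (assign alpha) @` Psi.

Record deductive_system := DeductiveSystem {
  entails :> set Fm -> Fm -> Prop;
  entails_refl : forall (G : set Fm) a, G a -> entails G a;
  entails_trans : forall (G P : set Fm) b,
    (forall a, P a -> entails G a) -> entails P b -> entails G b;
  entails_finitary : forall (G : set Fm) a, entails G a ->
    exists G' : set Fm, [/\ finite_set G', G' `<=` G & entails G' a];
  entails_subst : forall (G : set Fm) a (s : Fm -> Fm),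
    hom s -> entails G a -> entails (s @` G) (s a)
}.

Variable D : deductive_system.

Definition entails_all (G P : set Fm) : Prop := forall a, P a -> D G a.

Definition protoalgebraic : Prop :=
  let v1 : Fm := Var (vseq V 0) in
  let v2 : Fm := Var (vseq V 1) in
  exists L : set Fm,
    [/\ L `<=` Fm_below 2,
        entails_all set0 (inst L (tnth [tuple v1; v1]))
      & D ([set v1] `|` inst L (tnth [tuple v1; v2])) v2].

Definition inconsistent (X : set Fm) : Prop := forall a, D X a.

(* The family is indexed by the positive integers: [Psi 0] is irrelevant. *)
Definition elementary_IL_sequence (Psi : nat -> set Fm) : Prop :=
  forall n, 0 < n ->
    [/\ finite_set (Psi n),
        Psi n `<=` Fm_below n
      & forall (G : set Fm) (alpha : 'I_n -> Fm),
          inconsistent (G `|` range alpha) <->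
          entails_all G (inst (Psi n) alpha)].

Definition has_IL : Prop := exists Psi, elementary_IL_sequence Psi.

(* [psi] ranges over the repetition-free enumerations of [Psi n], so that
   k = #n. When k = 0 the first premise is already D G phi, so the condition
   holds whatever [Psi 0] is. *)
Definition has_WEML : Prop :=
  exists2 Psi, elementary_IL_sequence Psi &
    forall n, 0 < n ->
    forall (k : nat) (psi : 'I_k -> Fm), injective psi -> range psi = Psi n ->
    forall (G : set Fm) (alpha : 'I_n -> Fm) (phi : Fm),
      D (G `|` inst (Psi n) alpha) phi ->
      D (G `|` inst (inst (Psi k) psi) alpha) phi ->
      D G phi.

End Formulas.

Section Meets.
Variables (T : Type) (L : set (set T)).

(* M is the meet of the family X in L, ordered by inclusion. *)
Definition is_meet (X : set (set T)) (M : set T) : Prop :=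
  [/\ L M,
      forall G, X G -> M `<=` G
    & forall N, L N -> (forall G, X G -> N `<=` G) -> N `<=` M].

Definition meet_irreducible (F : set T) : Prop :=
  L F /\ forall G H, L G -> L H -> is_meet [set G; H] F -> F = G \/ F = H.

(* X may be empty, which excludes the top of L. *)
Definition completely_meet_irreducible (F : set T) : Prop :=
  L F /\ forall X, X `<=` L -> is_meet X F -> X F.

Definition has_greatest : Prop :=
  exists2 G, L G & forall H, L H -> H `<=` G.

End Meets.

Section Matrices.
Variables (S : signature) (V : variables) (D : deductive_system S V).
Variable A : algebra S.

Definition filters : set (set A) :=
  [set F | forall (G : set (Fm S V)) (a : Fm S V) (h : Fm S V -> A),
             D G a -> hom h -> h @` G `<=` F -> F (h a)].

(* [F, A) *)
Definition proper_interval (F : set A) : set (set A) :=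
  [set G | [/\ filters G, F `<=` G & G `<` [set: A]]].

Record congruence (r : A -> A -> Prop) : Prop := Congruence {
  congruence_equiv : RelationClasses.Equivalence r;
  congruence_op : forall (o : S) (a b : 'I_(arity o) -> A),
    (forall i, r (a i) (b i)) -> r (opA o a) (opA o b)
}.

Definition reduced (F : set A) : Prop :=
  forall r, congruence r ->
    (exists a b, r a b /\ a <> b) ->
    exists a b, [/\ r a b, F a & ~ F b].

(* <A, F> is a reduced matrix model that is subdirectly irreducible. *)
Definition si_reduced_model (F : set A) : Prop :=
  [/\ filters F, reduced F & completely_meet_irreducible filters F].

End Matrices.
Arguments filters {S V} D A _.

(* Main.v *)
Require Import Defs.
From mathcomp Require Import all_boot.
From mathcomp Require Import boolp classical_sets functions cardinality.

(** Two facts drive the equivalence. In a system with an inconsistency lemma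
    every filter lattice is compact: some finite set of formulas is
    inconsistent, so a filter that contains an instance of it is the whole
    algebra. And protoalgebraicity makes congruences behave well: a congruence
    compatible with a filter is compatible with every larger filter
    ([compatible_mono]), because equivalent elements [a], [b] satisfy
    [Lambda(a, b)] in the smaller filter.

    From WEML to a greatest proper filter. By compactness it suffices that the
    proper filters above a meet-irreducible [F] are directed, that is, that
    [G] and [H] proper have a proper join ([join_proper]). If the join is
    improper, finitely many [b_1, ..., b_n] in [H] are inconsistent with [G], so
    [Psi_n(b)] lies in [G] by the inconsistency lemma. The law WEML says, for
    theories, that the filter lattice is prime at the pair [Psi_n(b)],
    [Psi_#n Psi_n(b)], and this passes to every algebra: a meet-irreducible [F]
    contains one of the two sets ([meet_irreducible_prime]). If
    [Psi_n(b)] is in [F], it is in [H] along with [b], and [H] is improper; if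
    [Psi_#n Psi_n(b)] is in [F], it is in [G] along with [Psi_n(b)], and [G] is
    improper.

    The transfer from theories to filters of an arbitrary algebra rests on a
    description of the filter generated by [F] and [X] through one-step
    derivations ([generated]). The difficulty is that a derivation in [A]
    combines entailments read under different assignments. Any finite part of
    [A] is covered by the range of a single assignment [e], and finitely many
    formulas under another assignment can be rewritten by a substitution so as
    to have the same values under [e]; two formulas with the same value under
    [e] are interchangeable because the kernel of [e] is a congruence
    compatible with the preimage of [F]. So everything takes place in the
    preimages of [F] and [X] under one assignment.

    Completely meet-irreducible filters are meet-irreducible and proper, so the
    second condition implies the third. Finally, suppose that WEML fails for
    the IL-sequence at [G], [alpha], [phi]. A theory [T] that contains
    [G] and is maximal without [phi] contains neither [Psi_n(alpha)] nor
    [Psi_#n Psi_n(alpha)], so it is consistent with [alpha] and also with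
    [Psi_n(alpha)]. By [compatible_mono] the theories above [T] correspond to
    the filters above [T] in the quotient by the Leibniz congruence of [T], a
    subdirectly irreducible reduced model. A greatest proper theory above
    [T] would contain both [alpha] and [Psi_n(alpha)], which are jointly
    inconsistent. *)

Set Implicit Arguments.
Unset Strict Implicit.
Unset Printing Implicit Defensive.

Local Open Scope classical_set_scope.

(** * Finite, directed and irreducible families of sets *)

Lemma finite_enumeration (T : Type) (X : set T) :
  finite_set X -> exists k (f : 'I_k -> T), injective f /\ range f = X.
Proof.
elim/Peq: T X => T X /finite_seqP[s ->].
exists (size (undup s)), (tnth (in_tuple (undup s))); split.
  by apply/tuple_uniqP; rewrite undup_uniq.
apply/seteqP; split=> [_ [i _ <-]|x /= xs].
  by rewrite /= -mem_undup; apply: mem_tnth.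
have /tnthP[i ->] : x \in in_tuple (undup s) by rewrite mem_undup.
by exists i.
Qed.

Lemma directed_finite_sub (T : Type) (U : set (set T)) : U !=set0 ->
  (forall P Q, U P -> U Q -> exists R, [/\ U R, P `<=` R & Q `<=` R]) ->
  forall X, finite_set X -> X `<=` \bigcup_(P in U) P ->
  exists2 P, U P & X `<=` P.
Proof.
elim/Peq: T U => T U [P0 UP0] dir X /finite_seqP[s ->] {X}.
elim: s => [|x s IHs] sU; first by exists P0.
have [|P UP sP] := IHs; first by move=> y ys; apply: sU; rewrite /= inE ys orbT.
have [|Q UQ Qx] := sU x; first by rewrite /= inE eqxx.
have [R [UR PR QR]] := dir P Q UP UQ; exists R => // y /=.
by rewrite inE => /orP[/eqP->|/sP/PR//]; apply: QR.
Qed.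

Lemma properTE (T : Type) (G : set T) : G `<` [set: T] <-> G <> [set: T].
Proof.
split=> [[_ nG] GT|GT]; first by apply: nG; rewrite GT.
by split=> // TG; apply: GT; apply/seteqP.
Qed.

Section MeetIrreducibility.
Variables (T : Type) (L : set (set T)).

Lemma completely_meet_irreducible_meet (F : set T) :
  completely_meet_irreducible L F -> meet_irreducible L F.
Proof.
by move=> [LF irrF]; split=> // G H LG LH /irrF[_ [->|->]||] //; [left|right].
Qed.

(** The empty family has the top of [L] as its meet. *)
Lemma completely_meet_irreducible_proper (F : set T) :
  L setT -> completely_meet_irreducible L F -> F <> setT.
Proof.
move=> LT [_ irrF] FT; suff : set0 F by [].
by apply: irrF => //; rewrite FT; split=> // G [].
Qed.

End MeetIrreducibility.

(** * Evaluation of formulas *)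

Section Evaluation.
Variables (S : signature) (V : variables).
Local Notation Fm := (Fm S V).

Lemma finite_vars (phi : Fm) : finite_set (vars phi).
Proof.
elim: phi => [x|o a IHa] /=; first exact: finite_set1.
by apply: bigcup_finite.
Qed.

Lemma eq_eval (A : algebra S) (e e' : V -> A) (phi : Fm) :
  (forall x, vars phi x -> e x = e' x) -> eval e phi = eval e' phi.
Proof.
elim: phi => [x|o a IHa] /= ee'; first exact: ee'.
by congr opA; apply/funext => i; apply: IHa => x xa; apply: ee'; exists i.
Qed.

Lemma hom_eval (A B : algebra S) (g : A -> B) (e : V -> A) (phi : Fm) :
  hom g -> g (eval e phi) = eval (g \o e) phi.
Proof.
move=> gh; elim: phi => [//|o a IHa] /=.
by rewrite gh; congr opA; apply/funext => i /=; apply: IHa.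
Qed.

Lemma eval_is_hom (A : algebra S) (e : V -> A) : hom (A := Fm) (eval e).
Proof. by []. Qed.

Lemma eval_eval (A : algebra S) (e : V -> A) (s : V -> Fm) (phi : Fm) :
  eval e (eval s phi) = eval (eval e \o s) phi.
Proof. exact: (@hom_eval Fm A (eval e)). Qed.

Lemma eval_Var (phi : Fm) : eval (A := Fm) Var phi = phi.
Proof.
elim: phi => //= o a IHa.
by congr App; apply/funext => i; apply: IHa.
Qed.

Lemma homE (A : algebra S) (h : Fm -> A) : hom h -> h = eval (h \o Var).
Proof.
by move=> hh; apply/funext => phi; rewrite -hom_eval ?eval_Var.
Qed.

Lemma assign_vseq n (alpha : 'I_n -> Fm) (i : 'I_n) :
  assign alpha (vseq V i) = alpha i.
Proof.
rewrite /assign; case: pickP => [j /asboolP /vseq_inj ij|/(_ i)].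
  by congr alpha; apply: val_inj.
by move=> /asboolP.
Qed.

Lemma eval_assign n (alpha : 'I_n -> Fm) (A : algebra S) (e e' : V -> A)
    (psi : Fm) :
  Fm_below n psi -> (forall i, eval e (alpha i) = e' (vseq V i)) ->
  eval e (eval (assign alpha) psi) = eval e' psi.
Proof.
move=> psin ee'; rewrite eval_eval.
apply: eq_eval => x /psin[i /= ilt <-].
by rewrite (assign_vseq alpha (Ordinal ilt)).
Qed.

Lemma eval_inst n (alpha : 'I_n -> Fm) (Psi : set Fm) (s : V -> Fm) :
  Psi `<=` Fm_below n ->
  eval s @` inst Psi alpha = inst Psi (eval s \o alpha).
Proof.
move=> Psin; rewrite /inst image_comp; apply: eq_imagel => psi /Psin psin /=.
by apply: (@eval_assign _ _ Fm) => // i; rewrite assign_vseq.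
Qed.

(** There are infinitely many variables, so the range of one assignment can
    reach any finite part of an algebra of whatever cardinality. *)
Lemma finite_cover (A : algebra S) (K : set A) :
  finite_set K -> exists e : V -> A, K `<=` range e.
Proof.
move=> /finite_enumeration[k [f [_ <-]]].
have [a0] := algebra_nonempty A.
have /choice[e eE] (x : V) :
    exists a, forall i : 'I_k, x = vseq V i -> a = f i.
  have [[i ->]|noi] := EM (exists i : 'I_k, x = vseq V i).
    by exists (f i) => j /vseq_inj /val_inj ->.
  by exists a0 => i xi; case: noi; exists i.
by exists e => _ [i _ <-]; exists (vseq V i) => //; apply: eE.
Qed.

(** Finitely many formulas involve finitely many variables; an assignment [e']
    that attains the values of [e] at them factors [e] through the substitution
    which sends each such variable to one with the right value under [e']. *)
Lemma finite_factor (A : algebra S) (e : V -> A) (P : set Fm) : finite_set P ->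
  exists2 K : set A, finite_set K & forall e' : V -> A, K `<=` range e' ->
  exists s : V -> Fm, forall phi, P phi -> eval e' (eval s phi) = eval e phi.
Proof.
move=> Pfin; pose X := \bigcup_(phi in P) vars phi.
exists (e @` X).
  by apply/finite_image/bigcup_finite => // phi _; apply: finite_vars.
move=> e' cov.
have /choice[s sE] (x : V) : exists y : Fm, X x -> eval e' y = e x.
  have [Xx|?] := EM (X x); last by exists (Var x).
  by have [|y _ ye] := cov (e x); [exists x|exists (Var y)].
exists s => phi Pphi; rewrite eval_eval.
by apply: eq_eval => x xphi; apply: sE; exists phi.
Qed.

End Evaluation.

(** * Filters and the compatibility property *)

Section Filters.
Variables (S : signature) (V : variables) (D : deductive_system S V).
Local Notation Fm := (Fm S V).
Local Notation filters := (filters D).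

Lemma entails_mono (G G' : set Fm) (a : Fm) : G `<=` G' -> D G a -> D G' a.
Proof.
by move=> GG'; apply: entails_trans => b /GG'; apply: entails_refl.
Qed.

Lemma entails_all_finite (G P : set Fm) : finite_set P -> entails_all D G P ->
  exists G' : set Fm, [/\ finite_set G', G' `<=` G & entails_all D G' P].
Proof.
move=> Pfin GP.
have /choice[H HP] (a : Fm) : exists H : set Fm,
    P a -> [/\ finite_set H, H `<=` G & D H a].
  have [/GP/entails_finitary[H HP]|?] := EM (P a); last by exists set0.
  by exists H.
exists (\bigcup_(a in P) H a); split.
- by apply: bigcup_finite => // a /HP[].
- by apply: bigcup_sub => a /HP[].
- move=> a Pa; have [_ _] := HP a Pa.
  by apply: entails_mono; apply: bigcup_sup.
Qed.

Lemma filters_entailed (X : set Fm) : filters Fm [set a | D X a].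
Proof.
move=> G a h Ga hh hG; apply: (@entails_trans _ _ D X (h @` G)); last first.
  exact: entails_subst.
exact: hG.
Qed.

Lemma filter_eval (A : algebra S) (F : set A) (e : V -> A) (a : Fm) :
  filters A F -> D (eval e @^-1` F) a -> F (eval e a).
Proof.
by move=> AF /AF; apply; [exact: eval_is_hom|exact: image_preimage_subset].
Qed.

Lemma filter_entails (T : set Fm) (a : Fm) : filters Fm T -> D T a -> T a.
Proof.
move=> FT Ta; rewrite -(eval_Var a); apply: filter_eval FT _.
by apply: entails_mono Ta => b Tb; rewrite /preimage /= eval_Var.
Qed.

Lemma filters_preimage (A B : algebra S) (g : A -> B) (F : set B) :
  hom g -> filters B F -> filters A (g @^-1` F).
Proof.
move=> gh BF G a h Ga hh hG; apply: (BF G a (g \o h)) => //.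
  by move=> o b /=; rewrite hh gh.
by move=> _ [b Gb <-]; apply: hG; exists b.
Qed.

(** A homomorphism from formulas to [B] lifts along [g], variable by
    variable. *)
Lemma filters_surj (A B : algebra S) (g : A -> B) (G : set B) :
  hom g -> (forall b, exists a, g a = b) -> filters A (g @^-1` G) ->
  filters B G.
Proof.
move=> gh gsurj AG P a h Pa /homE hE hP.
have /choice[f fE] (x : V) : exists a, g a = h (Var x) by apply: gsurj.
have hfE c : h c = g (eval f c).
  by rewrite hE (hom_eval f c gh); apply: eq_eval => x _ /=.
rewrite hfE; apply: (AG P a (eval f) Pa (eval_is_hom f)).
by move=> _ [c Pc <-]; apply: hP; exists c => //; rewrite hfE.
Qed.

Lemma filters_bigcap (A : algebra S) (X : set (set A)) :
  X `<=` filters A -> filters A (\bigcap_(G in X) G).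
Proof.
move=> XA G a h Ga hh hG F XF; apply: (XA F XF G) => // b /hG.
exact.
Qed.

Lemma filters_directed_bigcup (A : algebra S) (U : set (set A)) :
  U `<=` filters A -> U !=set0 ->
  (forall P Q, U P -> U Q -> exists R, [/\ U R, P `<=` R & Q `<=` R]) ->
  filters A (\bigcup_(P in U) P).
Proof.
move=> UA U0 dir G a h Ga hh hG.
have [G' [G'fin G'G G'a]] := entails_finitary Ga.
have [|P UP hP] := directed_finite_sub U0 dir (finite_image h G'fin).
  by apply: subset_trans hG; apply: image_subset.
by exists P => //; apply: (UA P UP G').
Qed.

(** Any [Psi] and [v] with [Psi] the first member of an IL-sequence give one:
    the set of [Psi(v)] and [v], since [Psi(v)] entails itself. *)
Lemma exists_finite_inconsistent : has_IL D ->
  exists2 I : set Fm, finite_set I & inconsistent D I.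
Proof.
move=> [Psi IL]; have [//|Psifin _ ILP] := IL 1.
pose v : 'I_1 -> Fm := fun=> Var (vseq V 0).
exists (inst (Psi 1) v `|` range v).
  by rewrite finite_setU; split; apply: finite_image.
by apply/ILP => a va; apply: entails_refl.
Qed.

Lemma finite_inconsistent_sub (G : set Fm) : has_IL D -> inconsistent D G ->
  exists G' : set Fm, [/\ finite_set G', G' `<=` G & inconsistent D G'].
Proof.
move=> /exists_finite_inconsistent[I Ifin Iinc] Ginc.
have [|G' [G'fin G'G G'I]] := @entails_all_finite G I Ifin.
  by move=> a _; apply: Ginc.
by exists G'; split=> // a; apply: entails_trans G'I (Iinc a).
Qed.

(** After reduction to a finite [G], some variable does not occur in [G]. It is
    entailed by [G], and it can be given any value [c] without changing the
    values of [G]: so [c] is in [F]. *)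
Lemma filter_inconsistent (A : algebra S) (F : set A) (e : V -> A)
    (G : set Fm) :
  has_IL D -> filters A F -> inconsistent D G -> eval e @` G `<=` F ->
  F = [set: A].
Proof.
move=> DIL AF /(finite_inconsistent_sub DIL)[G' [G'fin G'G inc]] GF.
apply/seteqP; split=> // c _.
have [x xG] : exists x : V, ~ (\bigcup_(a in G') vars a) x.
  apply/existsNP => allx; apply: infinite_nat.
  have : finite_set [set: V].
    apply: sub_finite_set (fun x _ => allx x) _.
    by apply: bigcup_finite => // a _; apply: finite_vars.
  rewrite -(@preimage_setT _ _ (vseq V)); apply: finite_preimage.
  by move=> i j _ _; apply: vseq_inj.
pose e' y := if `[< y = x >] then c else e y.
have -> : c = eval e' (Var x) by rewrite /= /e'; case: asboolP.
apply: (AF G' _ _ (inc _) (eval_is_hom e')) => _ [a G'a <-].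
rewrite -(_ : eval e a = eval e' a).
  by apply: GF; exists a => //; apply: G'G.
apply: eq_eval => y ya; rewrite /e'; case: asboolP => // yx.
by case: xG; exists a => //; rewrite -yx.
Qed.

Definition compatible (A : algebra S) (r : A -> A -> Prop) (F : set A) :=
  forall a b, r a b -> F a -> F b.

Lemma congruence_eval (A : algebra S) (r : A -> A -> Prop) (e e' : V -> A)
    (phi : Fm) :
  congruence r -> (forall x, r (e x) (e' x)) -> r (eval e phi) (eval e' phi).
Proof.
by move=> rc ee'; elim: phi => [x|o a IHa] //=; apply: congruence_op.
Qed.

(** If [r a b], then [Lambda(a, a)] lies in [F], hence so does the [r]-related
    set [Lambda(a, b)]; in [G], which contains the latter, [a] can be traded
    for [b] by detachment. *)
Lemma compatible_mono (A : algebra S) (r : A -> A -> Prop) (F G : set A) :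
  protoalgebraic D -> congruence r -> filters A F -> filters A G ->
  F `<=` G -> compatible r F -> compatible r G.
Proof.
move=> [L [L2 Lrefl Ldet]] rc AF AG FG rF a b rab Ga.
(* [Lambda(a, a)] and [Lambda(a, b)] are the values of [L] at [e0] and [e1]. *)
pose e0 : V -> A := fun=> a.
pose e1 : V -> A := fun x => if `[< x = vseq V 1 >] then b else a.
have e10 : e1 (vseq V 0) = a.
  by rewrite /e1; case: asboolP => // /vseq_inj.
have e11 : e1 (vseq V 1) = b by rewrite /e1; case: asboolP.
rewrite -e11; apply: (AG _ _ _ Ldet (eval_is_hom e1)).
move=> _ [c [->|[l Ll <-]] <-] /=.
  by rewrite e10.
apply/FG/(rF (eval e0 l)).
  rewrite (@eval_assign _ _ _ _ _ _ e1) //; last first.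
  - by case; case=> [|[|]] //= ?; rewrite /tnth /=.
  - exact: L2.
  apply: congruence_eval => // x; rewrite /e1; case: asboolP => // _.
  by have [[]] := rc.
pose v1 : Fm := Var (vseq V 0).
have <- : eval e0 (eval (assign (tnth [tuple v1; v1])) l) = eval e0 l.
  apply: eval_assign; first exact: L2.
  by case; case=> [|[|]].
apply: (AF set0) => //; last by rewrite image_set0.
by apply: Lrefl; exists l.
Qed.

Lemma kernel_congruence (A B : algebra S) (g : A -> B) :
  hom g -> congruence (fun a b => g a = g b).
Proof.
move=> gh; split; first by split=> [a|a b|a b c] //= -> .
by move=> o a b ab; rewrite !gh; congr opA; apply/funext.
Qed.

(** [compatible_mono] for the kernel of [eval e] and the theory generated by
    [X]. *)
Lemma kernel_saturated (A : algebra S) (F : set A) (e : V -> A) (X : set Fm)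
    (a b : Fm) :
  protoalgebraic D -> filters A F -> eval e @^-1` F `<=` X ->
  eval e a = eval e b -> D X a -> D X b.
Proof.
move=> Dp AF FX.
have comp : compatible (A := Fm) (fun a b => eval e a = eval e b)
    [set a | D X a].
  apply: (@compatible_mono Fm _ (eval e @^-1` F)) => //.
  - exact: (kernel_congruence (eval_is_hom e)).
  - exact: (filters_preimage (eval_is_hom e) AF).
  - exact: filters_entailed.
  - by move=> c /FX; apply: entails_refl.
  - by move=> c d; rewrite /preimage /= => ->.
exact: comp.
Qed.

(** The filter generated by [F] and [X], when [F] is a filter of a
    protoalgebraic system. Asking for a derivation under every assignment whose
    range is large enough, instead of under some assignment, is what lets
    finitely many members be derived under a common one. *)
Definition generated (A : algebra S) (F X : set A) : set A :=
  [set b | exists2 K : set A, finite_set K &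
    forall e : V -> A, K `<=` range e ->
    forall a, eval e a = b -> D (eval e @^-1` (F `|` X)) a].

Lemma sub_generated (A : algebra S) (F X : set A) : F `|` X `<=` generated F X.
Proof.
move=> b FXb; exists set0 => // e _ a ab; apply: entails_refl.
by rewrite /preimage /= ab.
Qed.

(** Finitely many members of the generated filter, given as values of formulas,
    are derived simultaneously: the assignment is moved to one that covers all
    the finite sets of witnesses. The formulas in [Q] are only transported. *)
Lemma generated_eval (A : algebra S) (F X : set A) (e : V -> A) (P Q : set Fm) :
  finite_set P -> finite_set Q -> eval e @` P `<=` generated F X ->
  exists2 K : set A, finite_set K & forall e' : V -> A, K `<=` range e' ->
  exists2 s : V -> Fm,
    forall a, (P `|` Q) a -> eval e' (eval s a) = eval e a &
    entails_all D (eval e' @^-1` (F `|` X)) (eval s @` P).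
Proof.
move=> Pfin Qfin eP.
have /choice[K KP] (a : Fm) : exists K : set A, P a -> finite_set K /\
    forall e' : V -> A, K `<=` range e' ->
    forall a', eval e' a' = eval e a -> D (eval e' @^-1` (F `|` X)) a'.
  have [Pa|?] := EM (P a); last by exists set0.
  by have [|K] := eP (eval e a); [exists a|exists K].
have PQfin : finite_set (P `|` Q) by rewrite finite_setU.
have [K' K'fin K'P] := finite_factor e PQfin.
exists (K' `|` \bigcup_(a in P) K a).
  by rewrite finite_setU; split=> //; apply: bigcup_finite => // a /KP[].
move=> e' cov; have [|s sE] := K'P e'.
  by apply: subset_trans cov; apply: subsetUl.
exists s => // _ [a Pa <-]; have [_] := KP a Pa; apply; last by apply: sE; left.
by apply: subset_trans cov => k Kk; right; exists a.
Qed.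

(** Transported by [generated_eval], the premises of an entailment are all
    derivable under one assignment [e], hence so is its conclusion;
    [kernel_saturated] replaces the conclusion by any formula of the same
    value. *)
Lemma filters_generated (A : algebra S) (F X : set A) :
  protoalgebraic D -> filters A F -> filters A (generated F X).
Proof.
move=> Dp AF G a h Ga /homE hE hG.
have [G' [G'fin G'G {}Ga]] := entails_finitary Ga.
have hG' : eval (h \o Var) @` G' `<=` generated F X.
  by rewrite -hE; apply: subset_trans hG; apply: image_subset.
have [K Kfin KP] := generated_eval G'fin (finite_set1 a) hG'.
exists K => // e /KP[s sE sD] b ba.
have eab : eval e (eval s a) = eval e b by rewrite ba sE; [rewrite -hE|right].
apply: (kernel_saturated Dp AF _ eab).
  by apply: preimage_subset; apply: subsetUl.
by apply: entails_trans sD _; apply: entails_subst Ga.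
Qed.

End Filters.

(** * From the weak excluded middle to greatest proper filters *)

Section WEML.
Variables (S : signature) (V : variables) (D : deductive_system S V).
Hypothesis D_proto : protoalgebraic D.
Local Notation Fm := (Fm S V).
Local Notation filters := (filters D).

(** A rule of proof by cases, for all substitution instances of [P] and [Q],
    says that the theory generated by [G] is the intersection of those generated
    by adding [P] and by adding [Q]. Here it is transferred to filters: if [F]
    contains neither set of values, then irreducibility puts some [b] outside
    [F] into both generated filters, and both derivations of [b] can be read
    under a common assignment [e'], where the rule applies. *)
Lemma meet_irreducible_prime (A : algebra S) (F : set A) (e : V -> A)
    (P Q : set Fm) :
  finite_set P -> finite_set Q ->
  (forall (s : V -> Fm) (G : set Fm) (phi : Fm),
     D (G `|` eval s @` P) phi -> D (G `|` eval s @` Q) phi -> D G phi) ->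
  meet_irreducible (filters A) F -> eval e @` P `<=` F \/ eval e @` Q `<=` F.
Proof.
move=> Pfin Qfin PQ [AF irrF]; apply: contrapT => /not_orP[nP nQ].
have genF X : F `<=` generated D F X by move=> a Fa; apply: sub_generated; left.
have [b [[K Kfin KP] [L Lfin LQ] nFb]] : exists b,
    [/\ generated D F (eval e @` P) b, generated D F (eval e @` Q) b & ~ F b].
  apply: contrapT => nob.
  have meetF : is_meet (filters A)
      [set generated D F (eval e @` P); generated D F (eval e @` Q)] F.
    split=> // [G [->|->] //|N _ lbN b Nb].
    apply: contrapT => nFb; apply: nob; exists b.
    by split=> //; apply: lbN Nb; [left|right].
  have [||FE|FE] := irrF _ _ _ _ meetF; try exact: filters_generated.
  - by apply: nP; rewrite FE => a Pa; apply: sub_generated; right.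
  - by apply: nQ; rewrite FE => a Qa; apply: sub_generated; right.
have PQfin : finite_set (P `|` Q) by rewrite finite_setU.
have [M Mfin MP] := finite_factor e PQfin.
have [|e' cov] := @finite_cover S V A (K `|` L `|` M `|` [set b]).
  by rewrite !finite_setU; do !split.
have [|s sE] := MP e'; first by move=> a Ma; apply: cov; left; right.
have [|v _ vb] := cov b; first by right.
have red R : R `<=` P `|` Q -> D (eval e' @^-1` (F `|` eval e @` R)) (Var v) ->
    D (eval e' @^-1` F `|` eval s @` R) (Var v).
  move=> RPQ; apply: entails_trans => a [Fa|[p Rp pa]].
    by apply: entails_refl; left.
  apply: (@kernel_saturated _ _ D A F e' _ (eval s p)) => //.
    by rewrite sE//; apply: RPQ.
  by apply: entails_refl; right; exists p.
apply: nFb; rewrite -vb; apply: (filter_eval (a := Var v) AF).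
apply: (PQ s); apply: red.
- by move=> a; left.
- by apply: KP => // a Ka; apply: cov; do 3!left.
- by move=> a; right.
- by apply: LQ => // a La; apply: cov; do 2!left; right.
Qed.

Hypothesis D_IL : has_IL D.

(** The values of a finite inconsistent set are all generated, so
    [generated_eval] gives a substitution instance of it that is derivable under
    one assignment; the theory of the premises contains this instance, hence
    every formula. *)
Lemma generated_improper (A : algebra S) (F X : set A) :
  generated D F X = [set: A] ->
  exists e : V -> A, inconsistent D (eval e @^-1` (F `|` X)).
Proof.
move=> genT; have [I Ifin Iinc] := exists_finite_inconsistent D_IL.
have [a0] := algebra_nonempty A.
have [|K Kfin KP] :=
    @generated_eval S V D A F X (fun=> a0) I set0 Ifin (finite_set0 _).
  by rewrite genT.
have [e cov] := @finite_cover S V A K Kfin.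
exists e; have [s _ sI] := KP e cov.
have := filter_inconsistent (e := s) D_IL
  (@filters_entailed _ _ D (eval e @^-1` (F `|` X))) Iinc sI.
by move=> entT a; have : [set: Fm] a by []; rewrite -entT.
Qed.

Section Sequence.
Variable Psi : nat -> set Fm.
Hypothesis Psi_IL : elementary_IL_sequence D Psi.

Lemma IL_inconsistent n (alpha : 'I_n -> Fm) :
  0 < n -> inconsistent D (inst (Psi n) alpha `|` range alpha).
Proof.
by move=> /Psi_IL[_ _ IL]; apply/IL => a; apply: entails_refl.
Qed.

(** The double [Psi_#n Psi_n(alpha)] is [Psi_k] at the list [Psi_n(alpha)];
    hence it is inconsistent with [Psi_n(alpha)]. *)
Lemma inst_double n k (psi : 'I_k -> Fm) (alpha : 'I_n -> Fm) : 0 < k ->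
  inst (inst (Psi k) psi) alpha = inst (Psi k) (eval (assign alpha) \o psi).
Proof. by move=> /Psi_IL[_ Psik _]; apply: eval_inst. Qed.

Lemma range_inst n k (psi : 'I_k -> Fm) (alpha : 'I_n -> Fm) :
  range psi = Psi n -> range (eval (assign alpha) \o psi) = inst (Psi n) alpha.
Proof. by rewrite /inst => <-; rewrite image_comp. Qed.

(** If the join of [G] and [H] is improper, [beta] lists the part from [H] of a
    finite inconsistent set of premises. Then [G] contains [Psi_n(beta)], and
    [F] contains this set, making [H] improper, or its double, making [G]
    improper. *)
Lemma join_proper (A : algebra S) (F G H : set A) :
  (forall n, 0 < n -> forall k (psi : 'I_k -> Fm), injective psi ->
    range psi = Psi n -> forall (G : set Fm) (alpha : 'I_n -> Fm) (phi : Fm),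
    D (G `|` inst (Psi n) alpha) phi ->
    D (G `|` inst (inst (Psi k) psi) alpha) phi -> D G phi) ->
  meet_irreducible (filters A) F ->
  proper_interval D F G -> proper_interval D F H ->
  generated D G H <> [set: A].
Proof.
move=> wem irrF [AG FG /properTE GT] [AH FH /properTE HT] /generated_improper.
move=> [e /(finite_inconsistent_sub D_IL)[I [Ifin IGH Iinc]]].
have Hfin : finite_set (I `&` eval e @^-1` H) by apply: finite_setIl.
have [n [beta [_ betaE]]] := finite_enumeration Hfin.
have betaH i : H (eval e (beta i)).
  by have [] : (I `&` eval e @^-1` H) (beta i) by rewrite -betaE; exists i.
have Ibeta : I `<=` eval e @^-1` G `|` range beta.
  by move=> a Ia; have [Ga|Ha] := IGH a Ia; [left|right; rewrite betaE].
(* For [n = 0] the premises from [G] are inconsistent on their own. *)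
have [n0|n_gt0] := posnP n.
  apply: GT; apply: (filter_inconsistent D_IL AG Iinc (e := e)).
  move=> _ [a /Ibeta[Ga|[i _ _]] <- //].
  by case: i => i; rewrite n0.
have PsiG : eval e @` inst (Psi n) beta `<=` G.
  have [_ _ IL] := Psi_IL n_gt0.
  move=> _ [a Pa <-]; apply: (filter_eval AG).
  apply: ((IL (eval e @^-1` G) beta).1 _ a Pa) => b.
  exact: entails_mono Ibeta (Iinc b).
have PsiF : ~ eval e @` inst (Psi n) beta `<=` F.
  move=> PF; apply: HT.
  apply: (filter_inconsistent D_IL AH (IL_inconsistent beta n_gt0) (e := e)).
  by move=> _ [a [Pa|[i _ <-]] <-//]; apply/FH/PF; exists a.
have [Psifin Psin _] := Psi_IL n_gt0.
have [k [psi [psi_inj psiE]]] := finite_enumeration Psifin.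
(* For [k = 0] the set [Psi n] is empty, hence contained in [F]. *)
have [k0|k_gt0] := posnP k.
  apply: PsiF => b [_ [a Pa _] _]; move: Pa; rewrite -psiE => -[[i ltik] _ _].
  by rewrite k0 in ltik.
have [Psikfin Psik _] := Psi_IL k_gt0.
have [||s X phi|/PsiF//|PPF] :=
    @meet_irreducible_prime A F e (inst (Psi n) beta)
    (inst (inst (Psi k) psi) beta) _ _ _ irrF.
- exact: finite_image.
- by do 2!apply: finite_image.
- rewrite inst_double// !eval_inst// => DX DY.
  apply: (wem n n_gt0 k psi) DX _ => //.
  rewrite inst_double//.
  rewrite (_ : eval (assign _) \o psi =
    eval s \o (eval (assign beta) \o psi))//.
  apply/funext => i /=; apply/esym/(@eval_assign _ _ _ _ Fm).
    by apply: Psin; rewrite -psiE; exists i.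
  by move=> j; rewrite assign_vseq.
apply: GT; have gam := IL_inconsistent (eval (assign beta) \o psi) k_gt0.
apply: (filter_inconsistent D_IL AG gam (e := e)).
rewrite -inst_double// range_inst//.
by move=> _ [a [Pa|Pa] <-]; [apply/FG/PPF; exists a|apply: PsiG; exists a].
Qed.

End Sequence.

(** The union of a directed family of proper filters is a filter, and it is
    proper because a finite inconsistent set has all its values in the union
    only if they are all in one member. *)
Lemma WEML_greatest (A : algebra S) (F : set A) :
  has_WEML D -> meet_irreducible (filters A) F -> F <> [set: A] ->
  has_greatest (proper_interval D F).
Proof.
move=> [Psi IL wem] irrF FT; have AF := irrF.1.
have dir P Q : proper_interval D F P -> proper_interval D F Q ->
    exists R, [/\ proper_interval D F R, P `<=` R & Q `<=` R].
  move=> iP iQ; have [AP FP _] := iP.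
  have PG : P `<=` generated D P Q by move=> a Pa; apply: sub_generated; left.
  exists (generated D P Q); split=> //; last first.
    by move=> a Qa; apply: sub_generated; right.
  split; first exact: filters_generated.
    exact: subset_trans PG.
  by apply/properTE; apply: (join_proper IL wem irrF).
have int0 : proper_interval D F !=set0 by exists F; split=> //; apply/properTE.
exists (\bigcup_(P in proper_interval D F) P); last first.
  by move=> H iH a Ha; exists H.
split.
- by apply: filters_directed_bigcup => // P [].
- by move=> a Fa; exists F => //; split=> //; apply/properTE.
apply/properTE => UT.
have [I Ifin Iinc] := exists_finite_inconsistent D_IL.
have [a0] := algebra_nonempty A.
have [|P [AP _ /properTE PT] IP] :=
    directed_finite_sub int0 dir (finite_image (eval (fun=> a0)) Ifin).
  by rewrite UT.
by apply: PT; apply: (filter_inconsistent D_IL AP Iinc IP).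
Qed.

End WEML.

(** * Leibniz congruences and reduced quotients *)

Section LeibnizQuotient.
Variable S : signature.

(** The unary polynomial functions generated by basic operations with all but
    one argument fixed; they suffice to test congruences. *)
Inductive translation (A : algebra S) : (A -> A) -> Prop :=
| translation_id : translation id
| translation_op p (o : S) (i : 'I_(arity o)) (c : 'I_(arity o) -> A) :
    translation p ->
    translation (fun x => p (opA o (fun j => if j == i then x else c j))).

(** The Leibniz congruence, the largest congruence compatible with [F]. *)
Definition leibniz (A : algebra S) (F : set A) (a b : A) : Prop :=
  forall p, translation p -> (F (p a) <-> F (p b)).

Lemma translation_congruence (A : algebra S) (r : A -> A -> Prop) p (a b : A) :
  congruence r -> translation p -> r a b -> r (p a) (p b).
Proof.
move=> rc pt; elim: pt a b => [//|{}p o i c _ IHp] a b rab.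
apply/IHp/(congruence_op rc) => j; case: ifP => // _.
by have [[]] := rc.
Qed.

(** The arguments of an operation are exchanged one at a time. *)
Lemma leibniz_congruence (A : algebra S) (F : set A) : congruence (leibniz F).
Proof.
split; first split.
- by move=> a p _.
- by move=> a b ab p /ab->.
- by move=> a b c ab bc p pt; rewrite (ab p pt); apply: bc.
move=> o a b ab p pt.
(* [c k] has its first [k] arguments exchanged. *)
pose c k (j : 'I_(arity o)) := if j < k then b j else a j.
have hyb k : k <= arity o -> F (p (opA o a)) <-> F (p (opA o (c k))).
  elim: k => [_|k IHk ltk].
    by rewrite (_ : c 0 = a).
  rewrite (IHk (ltnW ltk)); pose i := Ordinal ltk.
  have := ab i _ (translation_op i (c k) pt).
  rewrite (_ : (fun j => if j == i then a i else c k j) = c k).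
    rewrite (_ : (fun j => if j == i then b i else c k j) = c k.+1) //.
    apply/funext => j; have [->|ji] := eqVneq j i.
      by rewrite /c /= ltnSn.
    by rewrite /c (@ltnS j) (@leq_eqVlt j k) (negbTE (ji : (j != k :> nat))).
  by apply/funext => j; case: eqP => // ->; rewrite /c /= ltnn.
rewrite (hyb _ (leqnn _)) (_ : c _ = b) //.
by apply/funext => j; rewrite /c ltn_ord.
Qed.

Lemma compatible_leibniz (A : algebra S) (F : set A) : compatible (leibniz F) F.
Proof. by move=> a b /(_ _ (translation_id A)) []. Qed.

Section Quotient.
Variables (A : algebra S) (r : A -> A -> Prop).

(** A class is encoded as the predicate [r a]; operations are computed on chosen
    representatives. *)
Definition class_of (a : A) : {X : set A | exists a, X = r a} :=
  exist _ (r a) (ex_intro _ a erefl).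

Definition class_repr (x : {X : set A | exists a, X = r a}) : A :=
  projT1 (cid (svalP x)).

Definition quotient : algebra S :=
  @Algebra S {X : set A | exists a, X = r a}
    (fun o x => class_of (opA o (class_repr \o x)))
    (let: inhabits a := algebra_nonempty A in inhabits (class_of a)).

Definition proj (a : A) : quotient := class_of a.

Lemma class_reprK (x : quotient) : proj (class_repr x) = x.
Proof.
case: x => X HX; apply: eq_exist; rewrite /class_repr.
by case: cid => a /= ->.
Qed.

Hypothesis rc : congruence r.

Lemma proj_eqP (a b : A) : proj a = proj b <-> r a b.
Proof.
have [[rxx rsym rtrans] _] := rc.
split=> [[rab]|rab]; first by rewrite rab; apply: rxx.
apply/eq_exist/seteqP; split=> c; last exact: rtrans.
exact/rtrans/rsym.
Qed.

Lemma proj_hom : hom proj.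
Proof.
move=> o a; apply: (proj_eqP _ _).2; apply: (congruence_op rc) => i /=.
by apply/proj_eqP; rewrite class_reprK.
Qed.

Lemma preimage_proj (F : set A) : compatible r F -> proj @^-1` (proj @` F) = F.
Proof.
move=> rF; apply/seteqP; split=> a; last by exists a.
by move=> [b Fb /proj_eqP/rF]; apply.
Qed.

End Quotient.

(** Distinct classes [x], [y] are separated by a translation [p]: of [p x] and
    [p y], exactly one is in the image of [F]. Any congruence relating [x] to
    [y] relates [p x] to [p y]. *)
Lemma reduced_leibniz (A : algebra S) (F : set A) :
  reduced (proj (leibniz F) @` F).
Proof.
have lc := leibniz_congruence F.
have FE := preimage_proj lc (@compatible_leibniz A F).
move=> r rc [x [y [rxy xy]]].
have pc : congruence (fun a b => r (proj (leibniz F) a) (proj (leibniz F) b)).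
  have [[rxx rsym rtrans] rop] := rc; split; first split.
  - by move=> a.
  - by move=> a b; apply: rsym.
  - by move=> a b c; apply: rtrans.
  - by move=> o a b rab; rewrite !proj_hom//; apply: rop.
have : ~ leibniz F (class_repr x) (class_repr y).
  by move=> /(proj_eqP lc); rewrite !class_reprK.
move=> /existsNP[p /not_implyP[pt nF]].
have rp : r (proj (leibniz F) (p (class_repr x)))
    (proj (leibniz F) (p (class_repr y))).
  by apply: (translation_congruence pc pt); rewrite !class_reprK.
have FP a : (proj (leibniz F) @` F) (proj (leibniz F) a) <-> F a.
  by split=> Fa; [rewrite -FE|exists a].
have [Fx|nFx] := EM (F (p (class_repr x))).
  exists (proj _ (p (class_repr x))), (proj _ (p (class_repr y))).
  by split; rewrite ?FP // => Fy; apply: nF.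
exists (proj _ (p (class_repr y))), (proj _ (p (class_repr x))).
split; rewrite ?FP //; first by have [[_ rsym _] _] := rc; apply: rsym.
by apply: contrapT => nFy; apply: nF.
Qed.

End LeibnizQuotient.

(** * From greatest proper filters to the weak excluded middle *)

Section Converse.
Variables (S : signature) (V : variables) (D : deductive_system S V).
Local Notation Fm := (Fm S V).
Local Notation filters := (filters D).

(** Zorn's lemma on the sets that do not entail [phi] together with [G]; a
    maximal one is closed under entailment. *)
Lemma maximal_theory (G : set Fm) (phi : Fm) : ~ D G phi ->
  exists T : set Fm, [/\ filters Fm T, G `<=` T, ~ T phi &
    forall T', filters Fm T' -> T `<=` T' -> ~ T' phi -> T' `<=` T].
Proof.
move=> nG.
have [U UP Utot|T [nT maxT]] := @Zorn_bigcup Fm [set X | ~ D (G `|` X) phi].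
  have [->|U0] := eqVneq U set0; first by rewrite /= bigcup_set0 setU0.
  move=> /entails_finitary[P [Pfin PGU Pphi]].
  have [X0 UX0] : U !=set0 by apply/set0P.
  pose W : set (set Fm) := [set G `|` X | X in U].
  have [|||_ [X UX <-] PX] := @directed_finite_sub _ W _ _ P Pfin.
  - by exists (G `|` X0), X0.
  - move=> _ _ [X UX <-] [Y UY <-].
    have [XY|YX] := Utot X Y UX UY.
      by exists (G `|` Y); split; [exists Y|apply: setUS|].
    by exists (G `|` X); split; [exists X| |apply: setUS].
  - move=> a /PGU[Ga|[X UX Xa]].
      by exists (G `|` X0); [exists X0|left].
    by exists (G `|` X); [exists X|right].
  - by apply: (UP X UX); apply: entails_mono Pphi.
have clT a : D (G `|` T) a -> T a.
  move=> Ta; apply: contrapT => nTa; apply: (maxT (T `|` [set a])).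
    by split=> [b|/(_ a) aT]; [left|apply/nTa/aT; right].
  move=> /= Taphi; apply: nT; apply: entails_trans Taphi.
  move=> b [Gb|[Tb|->//]]; apply: entails_refl; [left|right]=> //.
exists T; split.
- have -> : T = [set a | D (G `|` T) a].
    by apply/seteqP; split=> // a Ta; apply: entails_refl; right.
  exact: filters_entailed.
- by move=> a Ga; apply: clT; apply: entails_refl; left.
- by move=> Tphi; apply: nT; apply: entails_refl; right.
move=> T' FT' TT' nT'; apply: contrapT => nTT'.
apply: (maxT T'); first by split.
have GT : G `<=` T by move=> a Ga; apply: clT; apply: entails_refl; left.
move=> /= DT'; apply: nT'; apply: (filter_entails FT').
by apply: (entails_mono _ DT') => a [/GT/TT'|].
Qed.

(** If [F] is the meet of [X] and not in [X], all members of [X] are strictly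
    larger than [F], so they contain [c], and so does their intersection. *)
Lemma completely_meet_irreducible_avoiding (A : algebra S) (F : set A) (c : A) :
  filters A F -> ~ F c ->
  (forall G, filters A G -> F `<=` G -> ~ G c -> G `<=` F) ->
  completely_meet_irreducible (filters A) F.
Proof.
move=> AF nFc maxF; split=> // X XA [_ FX lbX].
apply: contrapT => nXF; apply: nFc.
apply: (lbX (\bigcap_(G in X) G)).
- exact: filters_bigcap.
- by move=> G XG; apply: bigcap_inf.
move=> G XG; apply: contrapT => nGc; apply: nXF.
have GF := maxF G (XA G XG) (FX G XG) nGc.
by rewrite (_ : F = G) //; apply/seteqP; split=> //; apply: FX.
Qed.

(** [T] is a theory that contains [G] and is maximal without [phi], [g] the
    projection to the quotient by its Leibniz congruence, and [M] the greatest
    proper filter above the image of [T]. *)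
Lemma greatest_WEML : protoalgebraic D -> has_IL D ->
  (forall (A : algebra S) (F : set A), si_reduced_model D F ->
     has_greatest (proper_interval D F)) ->
  has_WEML D.
Proof.
move=> Dp DIL gr; have [Psi IL] := DIL; exists Psi => //.
move=> n n_gt0 k psi psi_inj psiE G alpha phi D1 D2.
(* For [k = 0] the set [Psi n] is empty and the first premise suffices. *)
have [k0|k_gt0] := posnP k.
  apply: entails_trans D1 => a [Ga|[b Pb _]]; first exact: entails_refl.
  by move: Pb; rewrite -psiE => -[[i ltik] _ _]; rewrite k0 in ltik.
apply: contrapT => /maximal_theory[T [FT GT nT maxT]].
pose g := proj (leibniz T); have lc := leibniz_congruence T.
have gh : hom g := proj_hom lc.
have gsurj x : exists a, g a = x by exists (class_repr x); apply: class_reprK.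
(* Theories above [T] are unions of classes, so they correspond to filters. *)
have comp X : filters Fm X -> T `<=` X -> g @^-1` (g @` X) = X.
  move=> FX TX; apply: preimage_proj => //.
  exact: (compatible_mono Dp lc FT FX TX (@compatible_leibniz _ _ T)).
have imF X : filters Fm X -> T `<=` X -> filters _ (g @` X).
  by move=> FX TX; apply: (filters_surj gh gsurj); rewrite comp.
have si : si_reduced_model D (g @` T).
  split; [exact: imF|exact: reduced_leibniz|].
  apply: (@completely_meet_irreducible_avoiding _ _ (g phi)).
  - exact: imF.
  - by move=> gT; apply: nT; rewrite -(comp T FT).
  move=> H AH TH nH x Hx; have [a ax] := gsurj x.
  exists a => //; apply: (maxT (g @^-1` H)) => //.
  - exact: filters_preimage.
  - by move=> b Tb; apply: TH; exists b.
  - by rewrite /preimage /= ax.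
have [M [AM TM /properTE MT] maxM] := gr _ _ si.
(* The preimage of [M] is the greatest proper theory above [T]. *)
have inM X : filters Fm X -> T `<=` X -> X <> [set: Fm] -> X `<=` g @^-1` M.
  move=> FX TX XT a Xa; apply: (maxM (g @` X)); last by exists a.
  split; [exact: imF|exact: image_subset|].
  apply/properTE => gXT; apply: XT; rewrite -(comp X FX TX) gXT.
  exact: preimage_setT.
have consM m (beta : 'I_m -> Fm) : 0 < m ->
    ~ entails_all D T (inst (Psi m) beta) -> range beta `<=` g @^-1` M.
  move=> m_gt0 nP.
  apply: subset_trans (inM [set a | D (T `|` range beta) a] _ _ _).
  - by move=> a ra; apply: entails_refl; right.
  - exact: filters_entailed.
  - by move=> a Ta; apply: entails_refl; left.
  move=> XT; apply: nP; have [_ _ ILm] := IL m m_gt0; apply/ILm => a.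
  by have : [set: Fm] a by []; rewrite -XT.
have nT' X : D (G `|` X) phi -> ~ entails_all D T X.
  move=> DX TX; apply/nT/(filter_entails FT).
  apply: (entails_trans _ DX) => a [/GT Ta|/TX//]; exact: entails_refl.
have aM := consM n alpha n_gt0 (nT' _ D1).
have pM : inst (Psi n) alpha `<=` g @^-1` M.
  rewrite -(range_inst alpha psiE); apply: consM => //.
  by rewrite -(inst_double IL) //; apply: nT'.
have inc := IL_inconsistent IL alpha n_gt0.
apply: MT; apply: (filter_inconsistent (e := g \o Var) DIL AM inc).
by rewrite -(homE gh) => _ [a [/pM|/aM] Ma <-].
Qed.

End Converse.

Unset Implicit Arguments.

Theorem theorem6p3 (S : signature) (V : variables) (D : deductive_system S V)
    (D_proto : protoalgebraic D) (D_IL : has_IL D) :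
  (has_WEML D <->
     (forall (A : algebra S) (F : set A),
        meet_irreducible (filters D A) F -> F <> [set: A] ->
        has_greatest (proper_interval D F)))
  /\
  (has_WEML D <->
     (forall (A : algebra S) (F : set A),
        si_reduced_model D F ->
        has_greatest (proper_interval D F))).
Proof.
have i_ii : has_WEML D -> forall (A : algebra S) (F : set A),
    meet_irreducible (filters D A) F -> F <> [set: A] ->
    has_greatest (proper_interval D F).
  by move=> wem A F; apply: WEML_greatest.
have ii_iii : (forall (A : algebra S) (F : set A),
      meet_irreducible (filters D A) F -> F <> [set: A] ->
      has_greatest (proper_interval D F)) ->
    forall (A : algebra S) (F : set A), si_reduced_model D F ->
    has_greatest (proper_interval D F).
  move=> ii A F [_ _ irrF]; apply: ii.
    exact: completely_meet_irreducible_meet.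
  exact: completely_meet_irreducible_proper irrF.
have iii_i := greatest_WEML D_proto D_IL.
by split; split=> // H; [apply/iii_i/ii_iii|apply/ii_iii/i_ii].
Qed.
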